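(* Let $\mathcal G$ be a directed graph with vertex set $\{1,\dots,n\}$ and $m$ edges (self-loops included), and assume that $\mathcal G$ is strongly connected and has a self-loop on each vertex. Let $A$ be an $n\times n$ matrix consistent with $\mathcal G$ (i.e., $A_{uv}=0$ if $(v,u)$ is not an edge of $\mathcal G$), and let the $m$ entries of $A$ corresponding to the edges of $\mathcal G$ be free real-valued parameters $\lambda_1,\dots,\lambda_m$. Let the initial state be $\boldsymbol x(0)=(\xi_1,\dots,\xi_n)^T$ for free real-valued parameters $\xi_1,\dots,\xi_n$. Then, for each $r\in\{1,\dots,n\}$, the Hankel matrix $H^{(r)}_n$ satisfies $\operatorname{rank} H^{(r)}_n=n$ except for a set of parameters $(\lambda_1,\dots,\lambda_m,\xi_1,\dots,\xi_n)$ having zero Lebesgue measure in $\mathbb R^{m+n}$.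
   Context: An edge $(v,u)$ is directed from $v$ to $u$. A directed graph is strongly connected if for every pair of vertices $u,v$ there is a directed path from $u$ to $v$. Consider the discrete-time linear system $\boldsymbol x(k+1)=A\boldsymbol x(k)$, $k=0,1,2,\dots$, with initial state $\boldsymbol x(0)$. For $r\in\{1,\dots,n\}$ let $\boldsymbol e_r$ be the column vector with $1$ in position $r$ and $0$ elsewhere, and let $y^{(r)}(k)=\boldsymbol e_r^T\boldsymbol x(k)=\boldsymbol e_r^TA^k\boldsymbol x(0)$. For a positive integer $j$, the Hankel matrix $H^{(r)}_j$ is the $j\times j$ matrix whose entry in row $a$ and column $b$ ($1\le a,b\le j$) is $y^{(r)}(a+b-2)$. *)

(* Defs.v *)
From HB Require Import structures.
From mathcomp Require Import all_boot all_order all_algebra.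
From mathcomp Require Import all_classical all_reals all_analysis.

Set Implicit Arguments.
Unset Strict Implicit.
Unset Printing Implicit Defensive.

Import Order.TTheory GRing.Theory Num.Theory.
Import numFieldNormedType.Exports.

Local Open Scope classical_set_scope.
Local Open Scope ring_scope.

(* Lebesgue measure on R^N, where R^N is the type N.-tuple R with the Borel
   sigma-algebra: R^0 is a point of mass 1, and R^(N+1) carries the image of
   the product measure on R * R^N under the bijection (x, t) |-> x :: t.
   Lemma lebesgue_tuple_box checks that boxes get their usual volume. *)
Section lebesgue_tuple.
Local Open Scope ereal_scope.
Variable R : realType.
Local Notation T := (measurableTypeR R).

Definition tuple_cons N (xt : (T * N.-tuple T)%type) : N.+1.-tuple T :=
  [tuple of xt.1 :: xt.2].

Lemma measurable_tuple_cons N : measurable_fun setT (@tuple_cons N).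
Proof. exact: measurable_cons. Qed.

Section step.
Variables (N : nat) (nu : {sigma_finite_measure set (N.-tuple T) -> \bar R}).

Definition lebesgue_cons : set (N.+1.-tuple T) -> \bar R :=
  pushforward (lebesgue_measure \x nu) (@tuple_cons N).

HB.instance Definition _ := Measure.copy lebesgue_cons
  (measure_function_pushforward__canonical__measure_function_Measure
     (lebesgue_measure \x nu) (@measurable_tuple_cons N)).

Lemma lebesgue_consE (A : set T) (B : set (N.-tuple T)) :
  measurable A -> measurable B ->
  lebesgue_cons [set t | A (thead t) /\ B [tuple of behead t]] =
  lebesgue_measure A * nu B.
Proof.
move=> mA mB; rewrite /lebesgue_cons /pushforward -product_measure1E//.
congr (_ _); apply/seteqP.
by split=> -[x t] /=; rewrite theadE; move=> [Ax Bt]; split => //=;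
  move: Bt; congr B; apply: val_inj.
Qed.

Let lebesgue_cons_sigma_finite : sigma_finite setT lebesgue_cons.
Proof.
have /sigma_finiteP[F [TF ndF Foo]] := sigma_finiteT (@lebesgue_measure R).
have /sigma_finiteP[G [TG ndG Goo]] := sigma_finiteT nu.
exists (fun k => [set t | F k (thead t) /\ G k [tuple of behead t]]).
  apply/esym/seteqP; split=> // t _.
  have [i _ Fi] : (\bigcup_i F i) (thead t) by rewrite -TF.
  have [j _ Gj] : (\bigcup_j G j) [tuple of behead t] by rewrite -TG.
  exists (maxn i j) => //; split.
    by move: Fi; exact/subsetPset/ndF/leq_maxl.
  by move: Gj; exact/subsetPset/ndG/leq_maxr.
move=> k; have [mF Fk] := Foo k; have [mG Gk] := Goo k; split.
  apply: measurableI; rewrite -[X in measurable X]setTI.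
    exact: measurable_tnth.
  exact: measurable_behead.
by rewrite lebesgue_consE// lte_mul_pinfty// ge0_fin_numE.
Qed.

HB.instance Definition _ := Measure_isSigmaFinite.Build _ _ _
  lebesgue_cons lebesgue_cons_sigma_finite.

End step.

Fixpoint lebesgue_tuple (N : nat) :
    {sigma_finite_measure set (N.-tuple T) -> \bar R} :=
  match N with
  | 0 => \d_[tuple]
  | N'.+1 => lebesgue_cons (lebesgue_tuple N')
  end.

Lemma lebesgue_tuple_box (N : nat) (a b : 'I_N -> R) :
  (forall i, (a i <= b i)%R) ->
  lebesgue_tuple N [set t | forall i, `[a i, b i]%classic (tnth t i)] =
  (\prod_(i < N) (b i - a i))%:E.
Proof.
elim: N a b => [|N IHN] a b ab.
  by rewrite big_ord0 /= diracE mem_set//= => -[].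
rewrite big_ord_recl EFinM -(IHN (a \o lift ord0) (b \o lift ord0)) => [|i];
  last exact: ab.
have -> : (b ord0 - a ord0)%:E = lebesgue_measure `[a ord0, b ord0]%classic.
  rewrite lebesgue_measure_itv/= lte_fin; case: ltP => [//|ba].
  by rewrite (@le_anti _ _ (a ord0) (b ord0)) ?ab// subrr.
rewrite -lebesgue_consE//=; last first.
  rewrite (_ : mkset _ = \bigcap_(i in [set: 'I_N])
      ((@tnth _ T ^~ i) @^-1` `[a (lift ord0 i), b (lift ord0 i)])); last first.
    by apply/seteqP; split=> t /= h i; [move=> _|]; exact: h.
  apply: fin_bigcap_measurable => // i _.
  by rewrite -[X in measurable X]setTI; exact: measurable_tnth.
congr (lebesgue_cons _ _); apply/seteqP; split=> t; rewrite /mkset.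
- move=> abt; split; first exact: abt.
  by move=> i; have := abt (lift ord0 i); rewrite {1}(tuple_eta t) tnthS.
- move=> [ab0 abS] i; rewrite (tuple_eta t).
  by case: (unliftP ord0 i) => [j ->|->]; rewrite ?tnthS ?tnth0//; exact: abS.
Qed.

End lebesgue_tuple.
Arguments lebesgue_tuple : clear implicits.

(* e v u means that (v, u) is an edge, directed from v to u. *)
Definition strongly_connected n (e : rel 'I_n) : Prop :=
  forall u v, connect e u v.

Definition consistent_mx (R : pzRingType) n (e : rel 'I_n) (A : 'M[R]_n) : Prop :=
  forall u v, ~~ e v u -> A u v = 0.

Section linear_system.
Variables (R : pzRingType) (n : nat).
Implicit Types (A : 'M[R]_n) (xi : 'cV[R]_n) (r : 'I_n).

Definition state A xi (k : nat) : 'cV[R]_n := iter k (mulmx A) xi.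

Definition output A xi r (k : nat) : R :=
  ((delta_mx r 0 : 'cV[R]_n)^T *m state A xi k) 0 0.

Lemma outputE A xi r k :
  output A xi r k = ((delta_mx r 0 : 'cV[R]_n)^T *m (A ^+ k *m xi)) 0 0.
Proof.
rewrite /output; congr ((_ *m _) 0 0).
elim: k => [|k IHk] /=; first by rewrite expr0 mul1mx.
by rewrite IHk exprS mulmxA.
Qed.

End linear_system.

(* Indices start at 0 here, so the entry y (a + b - 2) becomes y (a + b). *)
Definition hankel_mx (R : Type) (j : nat) (y : nat -> R) : 'M[R]_j :=
  \matrix_(a < j, b < j) y (a + b)%N.

(* Main.v *)
Require Import Defs.
From HB Require Import structures.
From mathcomp Require Import all_boot all_order all_algebra.
From mathcomp Require Import finmap measurable_realfun.
From mathcomp Require Import all_classical all_reals all_analysis.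

Set Implicit Arguments.
Unset Strict Implicit.
Unset Printing Implicit Defensive.

Import Order.TTheory GRing.Theory Num.Theory.
Import numFieldNormedType.Exports.

Local Open Scope classical_set_scope.
Local Open Scope ring_scope.

(* det H is a polynomial in the parameters, and by Fubini the zero set of a
   nonzero polynomial is null, so one admissible system with det H <> 0 is
   enough. Take a spanning tree directed towards r, put weight 1 on its edges
   and distinct numbers d_w on the self-loops. Each d_w is an eigenvalue with an
   eigenvector supported on the tree path from w to r and nonzero at r. With
   the sum of these eigenvectors as initial state, y(k) = \sum_w c_w d_w^k with
   all c_w <> 0, so H = V diag(c) V^T with V the Vandermonde matrix of d. *)

(** * Hankel matrices of exponential sums *)

Lemma output_delta (F : pzRingType) n (A : 'M[F]_n) (xi : 'cV[F]_n) (r : 'I_n) k :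
  output A xi r k = (A ^+ k *m xi) r 0.
Proof. by rewrite outputE trmx_delta -rowE mxE. Qed.

Lemma det_hankel_exp_sum (F : comPzRingType) n (c d : 'rV[F]_n) :
  \det (hankel_mx n (fun k => \sum_w c 0 w * d 0 w ^+ k)) =
  (\prod_w c 0 w) * \det (Vandermonde n d) ^+ 2.
Proof.
have -> : hankel_mx n (fun k => \sum_w c 0 w * d 0 w ^+ k) =
    Vandermonde n d *m diag_mx c *m (Vandermonde n d)^T.
  apply/matrixP => a b; rewrite !mxE; apply: eq_bigr => w _.
  by rewrite mul_mx_diag !mxE exprD mulrA [c 0 w * _]mulrC.
by rewrite !det_mulmx det_tr det_diag mulrAC mulrC -expr2.
Qed.

Lemma det_Vandermonde_neq0 (F : idomainType) n (d : 'rV[F]_n) :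
  injective (d 0) -> \det (Vandermonde n d) != 0.
Proof.
move=> dI; rewrite det_Vandermonde; apply/prodf_neq0 => i _.
apply/prodf_neq0 => j ij; rewrite subr_eq0; apply: contraTneq ij => /dI ->.
by rewrite ltnn.
Qed.

(** The columns of [V] are eigenvectors and [V *m const_mx 1] is their sum, so the output at [r] is
    an exponential sum with the nonzero coefficients [V r w]. *)
Lemma hankel_eigenvectors_unitmx (F : fieldType) n (A V : 'M[F]_n) (d : 'rV[F]_n)
    (r : 'I_n) :
  injective (d 0) -> A *m V = V *m diag_mx d -> (forall w, V r w != 0) ->
  hankel_mx n (output A (V *m const_mx 1) r) \in unitmx.
Proof.
move=> dI AV Vr; rewrite unitmxE unitfE.
have -> : output A (V *m const_mx 1) r =
    (fun k => \sum_w (row r V) 0 w * d 0 w ^+ k).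
  apply/funext => k; rewrite output_delta mulmxA.
  have -> : A ^+ k *m V = V *m diag_mx (\row_w d 0 w ^+ k).
    elim: k => [|k IHk].
      rewrite expr0 mul1mx (_ : \row__ _ = const_mx 1) ?diag_const_mx ?mulmx1//.
      by apply/rowP => w; rewrite !mxE expr0.
    rewrite exprSr -mulmxA AV mulmxA IHk -mulmxA mulmx_diag.
    by congr (_ *m diag_mx _); apply/rowP => w; rewrite !mxE exprSr.
  by rewrite mxE; apply: eq_bigr => w _; rewrite mul_mx_diag !mxE mulr1.
rewrite det_hankel_exp_sum mulf_neq0 ?expf_neq0 ?det_Vandermonde_neq0//.
by apply/prodf_neq0 => w _; rewrite mxE.
Qed.

(** * A spanning tree directed towards [r] and its weighted matrix *)

Lemma connect_parent (T : finType) (e : rel T) (r : T) :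
  (forall v, connect e v r) ->
  exists (parent : T -> T) (h : T -> nat),
    forall v, v != r -> e v (parent v) /\ (h (parent v) < h v)%N.
Proof.
move=> e_r.
pose walk v k := [exists s : k.-tuple T, path e v s && (last v s == r)].
have walkP v s : path e v s -> last v s = r -> walk v (size s).
  by move=> es sr; apply/existsP; exists (in_tuple s); rewrite es sr eqxx.
have ex_walk v : exists k, walk v k.
  by have /connectP[s es sr] := e_r v; exists (size s); exact: walkP.
(* [h v] is the length of a shortest walk from [v] to [r]; the parent of [v] will be the second
   vertex of such a walk. *)
pose h v := ex_minn (ex_walk v).
suff /choice[parent parentP] v :
    exists u, v != r -> e v u /\ (h u < h v)%N by exists parent, h.
rewrite {2}/h; case: ex_minnP => k /existsP[s /andP[es /eqP sr]] _.
have sk := size_tuple s; case: s es sr sk => -[|u s] /= _ es sr sk.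
  by exists v; rewrite sr eqxx.
case/andP: es => vu es; exists u => _; split => //.
by rewrite /h; case: ex_minnP => j _ jmin; rewrite -sk ltnS jmin// walkP.
Qed.

Section tree.
Variables (F : fieldType) (n : nat) (e : rel 'I_n) (r : 'I_n).
Variables (parent : 'I_n -> 'I_n) (h : 'I_n -> nat) (d : 'I_n -> F).
Hypothesis parentP : forall v, v != r -> e v (parent v) /\ (h (parent v) < h v)%N.
Hypothesis e_loop : forall v, e v v.
Hypothesis d_inj : injective d.

(** Column [v] carries the edges leaving [v]: the self-loop of weight [d v] and, unless [v] is the
    root, the tree edge to its parent. *)
Definition tree_mx : 'M[F]_n :=
  \matrix_(u, v) (d u *+ (u == v) + ((v != r) && (u == parent v))%:R).

Lemma tree_mx_consistent : consistent_mx e tree_mx.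
Proof.
move=> u v; rewrite mxE; have [->|_] := eqVneq u v; first by rewrite e_loop.
case: (boolP (v != r)) => /= [vr|_]; last by rewrite addr0.
have [->|_] := eqVneq u (parent v); last by rewrite addr0.
by have [-> _] := parentP vr.
Qed.

Lemma tree_mx_delta v : tree_mx *m delta_mx v 0 =
  d v *: delta_mx v 0 + (if v == r then 0 else delta_mx (parent v) 0) :> 'cV_n.
Proof.
rewrite -colE; apply/colP => u; rewrite !mxE; congr (_ + _).
  by have [->|] := eqVneq u v; rewrite ?mulr1// mulr0.
by case: eqVneq => //= _; rewrite ?mxE ?andbT//.
Qed.

(* The solution is supported on the tree path from [z] to [r]. *)
Lemma tree_mx_resolvent l z c :
  (forall u, (h u <= h z)%N -> d u != l) -> c != 0 ->
  exists x : 'cV[F]_n, tree_mx *m x - l *: x = c *: delta_mx z 0 /\ x r 0 != 0.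
Proof.
have [k hz] := ubnP (h z); elim: k z hz c => // k IHk z hz c dl c0.
have dzl : d z - l != 0 by rewrite subr_eq0 dl.
(* This coefficient gives the right entry at [z]. If [z] is not the root, it leaves a residue [a] at
   the parent of [z], which the induction hypothesis for [- a] cancels. *)
pose a := c / (d z - l).
have a0 : a != 0 by rewrite mulf_neq0// invr_eq0.
have tree_z : tree_mx *m (a *: delta_mx z 0) - l *: (a *: delta_mx z 0) =
    c *: delta_mx z 0 + a *: (if z == r then 0 else delta_mx (parent z) 0) :> 'cV_n.
  rewrite -scalemxAr tree_mx_delta scalerDr !scalerA addrAC -scalerBl.
  by rewrite [l * a]mulrC -mulrBr /a divfK.
have [zr|zr] := eqVneq z r.
  exists (a *: delta_mx z 0); rewrite tree_z zr eqxx scaler0 addr0; split => //.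
  by rewrite !mxE !eqxx mulr1.
have [_ hpz] := parentP zr.
have [||| x [xE xr]] := IHk (parent z) _ (- a).
- exact: leq_trans hpz _.
- by move=> u hu; apply: dl; apply: leq_trans hu (ltnW hpz).
- by rewrite oppr_eq0.
exists (a *: delta_mx z 0 + x); split.
  rewrite mulmxDr scalerDr opprD addrACA tree_z xE (negbTE zr).
  by rewrite scaleNr -addrA subrr addr0.
by rewrite !mxE [r == _]eq_sym (negbTE zr) mulr0 add0r.
Qed.

Lemma tree_mx_eigenvector w :
  exists x : 'cV[F]_n, tree_mx *m x = d w *: x /\ x r 0 != 0.
Proof.
have [->|wr] := eqVneq w r.
  exists (delta_mx r 0); rewrite tree_mx_delta eqxx addr0.
  by rewrite mxE !eqxx oner_neq0.
have [_ hpw] := parentP wr.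
(* The unit vector at [w] fails to be an eigenvector by a 1 at the parent of [w], which [x] cancels.
   Vertices no higher than that parent differ from [w], so their loop weights differ from [d w]. *)
have [||x [xE xr]] := @tree_mx_resolvent (d w) (parent w) (- 1).
- move=> u hu; apply/eqP => /d_inj uw.
  by move: (leq_ltn_trans hu hpw); rewrite uw ltnn.
- by rewrite oppr_eq0 oner_eq0.
exists (delta_mx w 0 + x); split.
  rewrite mulmxDr tree_mx_delta (negbTE wr) scalerDr -addrA; congr (_ + _).
  by rewrite -[tree_mx *m x](subrK (d w *: x)) xE scaleN1r addrA subrr add0r.
by rewrite !mxE [r == _]eq_sym (negbTE wr) add0r.
Qed.

Lemma tree_mx_hankel :
  exists xi : 'cV[F]_n, hankel_mx n (output tree_mx xi r) \in unitmx.
Proof.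
have [x xP] := choice tree_mx_eigenvector.
pose V : 'M[F]_n := \matrix_(u, w) x w u 0.
have colV w : col w V = x w by apply/colP => u; rewrite !mxE.
exists (V *m const_mx 1).
apply: (@hankel_eigenvectors_unitmx _ _ _ _ (\row_w d w)).
- by move=> u v; rewrite !mxE => /d_inj.
- apply/matrixP => u w.
  have := congr1 (fun y : 'cV_n => y u 0) (xP w).1.
  rewrite -colV mul_mx_diag !mxE mulrC => <-.
  by apply: eq_bigr => v _; rewrite !mxE.
- by move=> w; rewrite mxE; case: (xP w).
Qed.

End tree.

Lemma exists_hankel_unitmx (F : numFieldType) n (e : rel 'I_n) (r : 'I_n) :
  strongly_connected e -> (forall v, e v v) ->
  exists (B : 'M[F]_n) (xi : 'cV[F]_n),
    consistent_mx e B /\ hankel_mx n (output B xi r) \in unitmx.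
Proof.
move=> e_conn e_loop.
have [parent [h parentP]] := @connect_parent _ e r (e_conn ^~ r).
(* The loop weights are the vertex indices, distinct in characteristic zero. *)
have d_inj : injective (fun w : 'I_n => (w : nat)%:R : F).
  by move=> u v /eqP; rewrite eqr_nat => /eqP /val_inj.
have [xi xiP] := tree_mx_hankel parentP d_inj.
by exists (tree_mx r parent (fun w => w%:R)), xi; split => //; exact: tree_mx_consistent parentP _.
Qed.

(** * Zero sets of polynomial functions *)

Lemma finite_roots (F : idomainType) (p : {poly F}) :
  p != 0 -> finite_set [set x | root p x].
Proof.
move=> p0; apply: contrapT => /(infinite_set_fset (size p))[B Bp].
rewrite leqNgt => /negP; apply; apply: (max_poly_roots p0); last exact: fset_uniq.
by apply/allP => x xB; exact: Bp.
Qed.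

Section polynomial_function.
Variable R : realType.
Local Notation T := (measurableTypeR R).

(** An inductive predicate, so that measurability and restriction to slices follow by induction on
    the construction of the function. *)
Inductive polyfun N : (N.-tuple T -> R) -> Prop :=
| polyfun_cst c : polyfun (fun=> c)
| polyfun_tnth i : polyfun (fun t => tnth t i)
| polyfunD f g : polyfun f -> polyfun g -> polyfun (fun t => f t + g t)
| polyfunM f g : polyfun f -> polyfun g -> polyfun (fun t => f t * g t).

Lemma polyfun_sum N (I : Type) (s : seq I) (P : pred I) (f : I -> N.-tuple T -> R) :
  (forall i, polyfun (f i)) -> polyfun (fun t => \sum_(i <- s | P i) f i t).
Proof.
move=> pf; elim: s => [|i s IHs].
  by under eq_fun do rewrite big_nil; exact: polyfun_cst.
under eq_fun do rewrite big_cons.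
by case: (P i) => //; exact: polyfunD.
Qed.

Lemma polyfun_prod N (I : Type) (s : seq I) (P : pred I) (f : I -> N.-tuple T -> R) :
  (forall i, polyfun (f i)) -> polyfun (fun t => \prod_(i <- s | P i) f i t).
Proof.
move=> pf; elim: s => [|i s IHs].
  by under eq_fun do rewrite big_nil; exact: polyfun_cst.
under eq_fun do rewrite big_cons.
by case: (P i) => //; exact: polyfunM.
Qed.

Lemma polyfun_det N n (M : N.-tuple T -> 'M[R]_n) :
  (forall i j, polyfun (fun t => M t i j)) -> polyfun (fun t => \det (M t)).
Proof.
move=> pM; apply: polyfun_sum => s; apply: polyfunM; first exact: polyfun_cst.
by apply: polyfun_prod => i; exact: pM.
Qed.

Lemma polyfun_output N n (A : N.-tuple T -> 'M[R]_n) (xi : N.-tuple T -> 'cV[R]_n)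
    (r : 'I_n) k :
  (forall i j, polyfun (fun t => A t i j)) ->
  (forall i, polyfun (fun t => xi t i 0)) ->
  polyfun (fun t => output (A t) (xi t) r k).
Proof.
move=> pA px; rewrite /output.
(* All coordinates of the state are treated at once, since multiplication by [A t] mixes them. *)
have : forall i, polyfun (fun t => state (A t) (xi t) k i 0).
  elim: k => //= k IHk i; under eq_fun do rewrite mxE.
  by apply: polyfun_sum => j; exact: polyfunM.
by move=> /(_ r); congr polyfun; apply/funext => t; rewrite trmx_delta -rowE mxE.
Qed.

Lemma measurable_polyfun N (f : N.-tuple T -> R) :
  polyfun f -> measurable_fun setT (f : N.-tuple T -> T).
Proof.
elim=> [c|i|g h _ mg _ mh|g h _ mg _ mh].
- exact: measurable_cst.
- exact: measurable_tnth.
- exact: measurable_funD.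
- exact: measurable_funM.
Qed.

Lemma polyfun_cons N (f : N.+1.-tuple T -> R) x :
  polyfun f -> polyfun (fun t : N.-tuple T => f (tuple_cons (x, t))).
Proof.
elim=> [c|i|g h _ pg _ ph|g h _ pg _ ph].
- exact: polyfun_cst.
- case: (unliftP ord0 i) => [j ->|->].
    under eq_fun do rewrite tnthS.
    exact: polyfun_tnth.
  under eq_fun do rewrite tnth0.
  exact: polyfun_cst.
- exact: polyfunD.
- exact: polyfunM.
Qed.

(** Each constructor matches an operation on univariate polynomials: frozen coordinates become
    constants and the first coordinate becomes ['X]. *)
Lemma polyfun_head N (f : N.+1.-tuple T -> R) (t : N.-tuple T) :
  polyfun f -> exists p : {poly R}, forall x, f (tuple_cons (x, t)) = p.[x].
Proof.
elim=> [c|i|g h _ [p gp] _ [q hq]|g h _ [p gp] _ [q hq]].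
- by exists c%:P => x; rewrite hornerC.
- case: (unliftP ord0 i) => [j ->|->].
    by exists (tnth t j)%:P => x; rewrite tnthS hornerC.
  by exists 'X => x; rewrite tnth0 hornerX.
- by exists (p + q) => x; rewrite hornerD gp hq.
- by exists (p * q) => x; rewrite hornerM gp hq.
Qed.

Lemma measurable_polyfun_zeros N (f : N.-tuple T -> R) :
  polyfun f -> measurable [set t | f t = 0].
Proof.
move=> /measurable_polyfun mf.
by rewrite -[X in measurable X]setTI; exact: mf measurableT _ (measurable_set1 0).
Qed.

(* By Fubini, slicing along the first coordinate: the slice at [x] is null
   by induction unless [f] vanishes on all of it, and this happens for at most
   finitely many [x], the roots of the nonzero polynomial [x |-> f (x :: t0)]. *)
Lemma polyfun_zeros_null N (f : N.-tuple T -> R) (t0 : N.-tuple T) :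
  polyfun f -> f t0 != 0 -> lebesgue_tuple R N [set t | f t = 0] = 0%E.
Proof.
elim: N f t0 => [|N IHN] f t0 pf ft0.
  (* In dimension 0 there is a single point, and [f] is nonzero there. *)
  by rewrite /= diracE memNset//= => f0; move: ft0; rewrite [t0]tuple0 f0 eqxx.
have [x0 [t1 t0E]] : exists x0 t1, t0 = tuple_cons (x0, t1).
  by exists (thead t0), [tuple of behead t0]; rewrite {1}(tuple_eta t0).
have [p fp] := polyfun_head t1 pf.
have p0 : p != 0.
  by apply: contraNneq ft0 => p0; rewrite t0E fp p0 horner0.
pose Z := (@tuple_cons R N) @^-1` [set t | f t = 0].
have mZ : measurable Z.
  rewrite -[X in measurable X]setTI; apply: measurable_tuple_cons => //.
  exact: measurable_polyfun_zeros.
(* By construction the measure in dimension [N.+1] is the image of a product, so its value is the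
   integral over [x] of the measures of the slices. *)
change (product_measure1 (@lebesgue_measure R) (lebesgue_tuple R N) Z = 0%E).
rewrite /product_measure1 -(integral0 (@lebesgue_measure R) setT).
apply: ge0_ae_eq_integral => //.
- exact: measurable_fun_xsection.
- exists [set x | root p x]; split.
  + exact/countable_measurable/finite_set_countable/finite_roots.
  + exact/countable_lebesgue_measure0/finite_set_countable/finite_roots.
  move=> x /=; apply: contra_notP => /negP px _.
  rewrite [X in lebesgue_tuple R N X](_ : _ = [set t | f (tuple_cons (x, t)) = 0]).
    by rewrite (IHN _ t1)//; [exact: polyfun_cons|rewrite fp].
  by apply/seteqP; split=> t; rewrite /xsection /= inE.
Qed.

End polynomial_function.

(** * Full rank for almost all parameters *)

Theorem theorem1 (R : realType) (n m : nat) (e : rel 'I_n)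
    (edge : 'I_m -> 'I_n * 'I_n)
    (edge_inj : injective edge)
    (edge_codom : forall v u, e v u = ((v, u) \in codom edge))
    (e_conn : strongly_connected e)
    (e_loop : forall v, e v v)
    (A : (m + n).-tuple (measurableTypeR R) -> 'M[R]_n)
    (A_consistent : forall p, consistent_mx e (A p))
    (A_param : forall p i, A p (edge i).2 (edge i).1 = tnth p (lshift n i))
    (x0 : (m + n).-tuple (measurableTypeR R) -> 'cV[R]_n)
    (x0_param : forall p i, x0 p i 0 = tnth p (rshift m i))
    (r : 'I_n) :
  (lebesgue_tuple R (m + n)).-negligible
    [set p | \rank (hankel_mx n (output (A p) (x0 p) r)) <> n].
Proof.
have pA u v : polyfun (fun p => A p u v).
  have [|nevu] := boolP (e v u); last first.
    by under eq_fun do rewrite A_consistent//; exact: polyfun_cst.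
  rewrite edge_codom => /codomP[i vuE].
  have -> : (fun p => A p u v) = fun p => tnth p (lshift n i).
    by apply/funext => p; rewrite -A_param -vuE.
  exact: polyfun_tnth.
have px i : polyfun (fun p => x0 p i 0).
  by under eq_fun do rewrite x0_param; exact: polyfun_tnth.
pose H p := hankel_mx n (output (A p) (x0 p) r).
have pH : polyfun (fun p => \det (H p)).
  apply: polyfun_det => i j; under eq_fun do rewrite mxE.
  exact: polyfun_output.
have [B [xi [B_consistent Bxi]]] := exists_hankel_unitmx R r e_conn e_loop.
(* The parameters of the witness: the entries of [B] on the edges, then the initial state [xi]. Off
   the edges both [A p0] and [B] vanish. *)
pose p0 : (m + n).-tuple (measurableTypeR R) :=
  [tuple match fintype.split k with
         | inl i => B (edge i).2 (edge i).1 | inr j => xi j 0 end | k < m + n].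
have AB : A p0 = B.
  apply/matrixP => u v; have [|nevu] := boolP (e v u); last first.
    by rewrite A_consistent// B_consistent.
  rewrite edge_codom => /codomP[i vuE].
  have /= := A_param p0 i; rewrite -vuE /= => ->.
  by rewrite tnth_mktuple (unsplitK (inl i)) -vuE.
have x0xi : x0 p0 = xi.
  by apply/colP => j; rewrite x0_param tnth_mktuple (unsplitK (inr j)).
have p0H : \det (H p0) != 0 by rewrite /H AB x0xi -unitfE -unitmxE.
(* A measurable null set covering the exceptional one, as a nonzero determinant forces full rank. *)
exists [set p | \det (H p) = 0]; split.
- exact: measurable_polyfun_zeros.
- exact: polyfun_zeros_null pH p0H.
move=> p /=; apply: contra_notP => /eqP Hp.
by apply/eqP; rewrite -/(row_free _) row_free_unit unitmxE unitfE.
Qed.
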